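(* Let $G$ be a simple graph of $n$ vertices and let $F=\{f_i\}_{i\in[n]}$ be a $G(n,k)$-frame. If $F$ is a tight frame for $\mathbb{C}^k$, then each connected component of $G$ is regular.
   Context: $[n]=\{1,\dots,n\}$. A sequence $\{f_i\}_{i\in[n]}$ in $\mathbb{C}^k$ is a frame for $\mathbb{C}^k$ if there are constants $A,B>0$ with $A\|f\|^2\le\sum_{i\in[n]}|\langle f,f_i\rangle|^2\le B\|f\|^2$ for all $f\in\mathbb{C}^k$; it is a tight frame if one can take $A=B$. Its Gramian matrix is the $n\times n$ matrix whose $(i,j)$ entry is $\langle f_j,f_i\rangle$ (inner product linear in the first argument). The Laplacian matrix of a simple graph $G$ with vertices $v_1,\dots,v_n$ is $L(G)=D(G)-A(G)$, where $D(G)$ is the diagonal matrix of vertex degrees and $A(G)$ is the adjacency matrix. A frame $\{f_i\}_{i\in[n]}$ for $\mathbb{C}^k$ is a $G(n,k)$-frame if its Gramian matrix equals $L(G)$. A graph is regular if all its vertices have the same degree. *)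

(* Defs.v *)
From HB Require Import structures.
From mathcomp Require Import all_boot all_order all_algebra.
From mathcomp Require Export sesquilinear spectral.
From mathcomp Require Export reals complex.

Set Implicit Arguments.
Unset Strict Implicit.
Unset Printing Implicit Defensive.

Import Order.TTheory GRing.Theory Num.Theory.
Local Open Scope ring_scope.
Local Open Scope complex_scope.

Section Graphs.

Record sgraph (T : finType) := SGraph {
  adj : rel T;
  adj_sym : symmetric adj;
  adj_irrefl : irreflexive adj
}.

Definition degree (T : finType) (G : sgraph T) (v : T) : nat :=
  #|[set w | adj G v w]|.

Definition regular (T : finType) (G : sgraph T) : Prop :=
  forall u v : T, degree G u = degree G v.

Section Induced.
Variables (T : finType) (G : sgraph T) (S : {set T}).

Definition induced_adj : rel {v : T | v \in S} :=
  fun u v => adj G (val u) (val v).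

Fact induced_adj_sym : symmetric induced_adj.
Proof. by move=> u v; apply: adj_sym. Qed.

Fact induced_adj_irrefl : irreflexive induced_adj.
Proof. by move=> u; apply: adj_irrefl. Qed.

Definition induced : sgraph {v : T | v \in S} :=
  SGraph induced_adj_sym induced_adj_irrefl.
End Induced.

Definition components (T : finType) (G : sgraph T) : {set {set T}} :=
  [set [set w | connect (adj G) v w] | v : T].

End Graphs.

Section Matrices.
Variables (C : pzRingType) (n : nat) (G : sgraph 'I_n).

Definition adjacency_mx : 'M[C]_n := \matrix_(i, j) (adj G i j)%:R.

Definition degree_mx : 'M[C]_n := diag_mx (\row_i (degree G i)%:R).

Definition laplacian_mx : 'M[C]_n := degree_mx - adjacency_mx.

End Matrices.
Arguments laplacian_mx C {n} G.

Section Frames.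
Variables (R : realType) (n k : nat).
Implicit Type F : 'I_n -> 'rV[R[i]]_k.

(* [dotmx u v] is the standard inner product of C^k, linear in [u] and
   conjugate-linear in [v], so that [dotmx f f] is the squared norm of [f].
   For complex numbers, [x <= y] says that [y - x] is a nonnegative real;
   both sides of the inequalities below are real. *)
Definition frame_bounds F (A B : R) : Prop :=
  forall f : 'rV[R[i]]_k,
    A%:C * dotmx f f <= \sum_i `|dotmx f (F i)| ^+ 2 /\
    \sum_i `|dotmx f (F i)| ^+ 2 <= B%:C * dotmx f f.

Definition is_frame F : Prop :=
  exists A B : R, [/\ 0 < A, 0 < B & frame_bounds F A B].

Definition is_tight_frame F : Prop :=
  exists A : R, 0 < A /\ frame_bounds F A A.

Definition gramian F : 'M[R[i]]_n := \matrix_(i, j) dotmx (F j) (F i).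

Definition is_graph_frame (G : sgraph 'I_n) F : Prop :=
  is_frame F /\ gramian F = laplacian_mx R[i] G.

Fact dotmx_sumE (u v : 'rV[R[i]]_k) :
  dotmx u v = \sum_(l < k) u 0 l * (v 0 l)^*%C.
Proof. by rewrite dotmxE mxE; apply: eq_bigr => l _; rewrite !mxE. Qed.

End Frames.

(* Main.v *)
Require Import Defs.
From mathcomp Require Import all_boot all_order all_algebra.
From mathcomp Require Import reals complex.

Set Implicit Arguments.
Unset Strict Implicit.
Unset Printing Implicit Defensive.

Import Order.TTheory GRing.Theory Num.Theory.
Local Open Scope ring_scope.

(** The tight frame identity [\sum_i |<f, F_i>|^2 = A |f|^2] is tested on the
    frame vectors alone.  For [f = F_j] the numbers [<F_j, F_i>] form column
    [j] of the Laplacian, whose squared norm is [d_j ^ 2 + d_j]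
    ([sum_sqr_laplacian_col]), while [|F_j|^2 = d_j].  Hence
    [d_j ^ 2 + d_j = A d_j], and every vertex that is not isolated has the same
    degree [A - 1] ([tight_frame_degree]).  Adjacent vertices are never
    isolated, so the degree is constant along edges and therefore on connected
    components; and since a component contains all neighbours of its vertices,
    degrees in the induced subgraph are degrees in the whole graph
    ([degree_induced]). *)

Lemma degree_gt0 (T : finType) (G : sgraph T) (u v : T) :
  adj G u v -> (0 < degree G u)%N.
Proof. by move=> uv; rewrite card_gt0; apply/set0Pn; exists v; rewrite inE. Qed.

Lemma degree_induced (T : finType) (G : sgraph T) (S : {set T})
    (v : {v : T | v \in S}) :
  closed (adj G) (mem S) -> degree (induced G S) v = degree G (val v).
Proof.
move=> clS; rewrite /degree -(card_imset _ val_inj).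
apply: eq_card => w; rewrite inE; apply/imsetP/idP => [[x + ->]|vw].
  by rewrite inE.
have wS : w \in S by rewrite -(clS _ _ vw) (valP v).
by exists (exist _ w wS); rewrite ?inE.
Qed.

Lemma connect_eq_degree (T : finType) (G : sgraph T) :
  (forall u v, adj G u v -> degree G u = degree G v) ->
  forall u v, connect (adj G) u v -> degree G u = degree G v.
Proof.
move=> adj_deg u v uv; apply/esym/eqP.
have cl : closed (adj G) [pred w | degree G w == degree G u].
  by move=> x y /adj_deg; rewrite !inE => ->.
by have := closed_connect cl uv; rewrite !inE eqxx.
Qed.

Lemma component_closed (T : finType) (G : sgraph T) (S : {set T}) :
  S \in components G -> closed (adj G) (mem S).
Proof.
case/imsetP=> x _ -> u v uv; rewrite !inE.
exact: (same_connect_r (sym_connect_sym (@adj_sym _ G)) (connect1 uv)).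
Qed.

Lemma component_connect (T : finType) (G : sgraph T) (S : {set T}) (u v : T) :
  S \in components G -> u \in S -> v \in S -> connect (adj G) u v.
Proof.
case/imsetP=> x _ ->; rewrite !inE => xu; apply: connect_trans.
by rewrite (sym_connect_sym (@adj_sym _ G)).
Qed.

Lemma laplacian_diag (C : pzRingType) (n : nat) (G : sgraph 'I_n) (j : 'I_n) :
  laplacian_mx C G j j = (degree G j)%:R.
Proof. by rewrite !mxE eqxx adj_irrefl subr0. Qed.

Lemma sum_sqr_laplacian_col (C : numDomainType) (n : nat) (G : sgraph 'I_n)
    (j : 'I_n) :
  \sum_i `|laplacian_mx C G i j| ^+ 2 =
  (degree G j)%:R ^+ 2 + (degree G j)%:R.
Proof.
rewrite (bigD1 j) //= laplacian_diag normr_nat; congr (_ + _).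
rewrite /degree -sum1dep_card natr_sum big_mkcond [RHS]big_mkcond /=.
apply: eq_bigr => i _; rewrite !mxE adj_sym.
case: (eqVneq i j) => [->|_] /=; first by rewrite adj_irrefl.
by rewrite sub0r normrN; case: (adj G j i); rewrite ?normr1 ?normr0 ?expr1n ?expr0n.
Qed.

(** Cancelling [d_j] in [d_j ^ 2 + d_j = A d_j], the tight frame identity
    at the vector [F j]. *)
Lemma tight_frame_degree (R : realType) (n k : nat) (G : sgraph 'I_n)
    (F : 'I_n -> 'rV[R[i]%C]_k) (A : R) :
  gramian F = laplacian_mx R[i]%C G -> frame_bounds F A A ->
  forall j, (0 < degree G j)%N -> ((degree G j).+1)%:R = A%:C%C.
Proof.
move=> gramF tightF j dj.
have dotF i : dotmx (F j) (F i) = laplacian_mx R[i]%C G i j.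
  by rewrite -gramF mxE.
have /andP/le_anti := tightF (F j).
have -> : \sum_i `|dotmx (F j) (F i)| ^+ 2 =
          \sum_i `|laplacian_mx R[i]%C G i j| ^+ 2.
  by apply: eq_bigr => i _; rewrite dotF.
rewrite dotF laplacian_diag sum_sqr_laplacian_col.
rewrite expr2 -[X in _ + X]mul1r -mulrDl natr1.
by move/mulIf => ->//; rewrite pnatr_eq0 -lt0n.
Qed.

Theorem theorem4p1 (R : realType) (n k : nat) (G : sgraph 'I_n)
    (F : 'I_n -> 'rV[R[i]%C]_k)
    (hF : is_graph_frame G F) (hT : is_tight_frame F) :
  forall S : {set 'I_n}, S \in components G -> regular (induced G S).
Proof.
case: hF => _ gramF; case: hT => A [_ tightF] S compS u v.
have adj_deg x y : adj G x y -> degree G x = degree G y.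
  move=> xy; have yx : adj G y x by rewrite adj_sym.
  have degE := tight_frame_degree gramF tightF.
  apply/eqP; rewrite -eqSS -(eqr_nat R[i]%C).
  by rewrite (degE _ (degree_gt0 xy)) (degE _ (degree_gt0 yx)).
have clS := component_closed compS.
rewrite !degree_induced //; apply: connect_eq_degree => //.
exact: component_connect compS (valP u) (valP v).
Qed.
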